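(* Let $0<\alpha<1/2$ and $\kappa>1$. Consider the tensor PCA model $\mathcal Y=\mathcal T+\mathcal Z$ with $\mathcal Y,\mathcal T,\mathcal Z\in\mathbb R^{p_1\times p_2\times p_3}$, where the entries of $\mathcal Z$ are i.i.d. $N(0,\sigma^2)$ and the observed data are $\mathcal D=\mathcal Y$. Let $\mathcal A\in\mathbb R^{p_1\times p_2\times p_3}$ be a loading tensor. Then there exists a constant $c_3>0$ such that, for every signal tensor $\mathcal T=\mathcal G\times_1U_1\times_2U_2\times_3U_3\in\Theta(\underline\lambda,\kappa)$, $$\inf_{\mathrm{CI}\in\mathcal I_\alpha(\Theta,\mathcal A)}\ \sup_{\mathcal T'\in\Theta(\underline\lambda,\kappa)}\mathbb E_{\mathcal T'}\,L(\mathrm{CI}(\mathcal D))\ \ge\ c_3\,\sigma\sqrt{\sum_{j=1}^3\|\mathcal P_{U_{j\perp}}A_j\mathcal P_{(U_{j+2}\otimes U_{j+1})G_j^\top}\|_{\mathrm F}^2+\|\mathcal A\times_1U_1^\top\times_2U_2^\top\times_3U_3^\top\|_{\mathrm F}^2},$$ where $L(\cdot)$ is the length of the confidence interval.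
   Context: Mode indices are modulo 3. $\mathrm{Mat}_j(\mathcal M)\in\mathbb R^{p_j\times p_{j+2}p_{j+1}}$ is the mode-$j$ matricization, $[\mathrm{Mat}_j(\mathcal M)]_{k_j,k_{j+1}+p_{j+1}(k_{j+2}-1)}=\mathcal M_{k_1,k_2,k_3}$; $\times_j$ is the mode-$j$ product, $\mathrm{Mat}_j(\mathcal M\times_jV)=V\mathrm{Mat}_j(\mathcal M)$; $\otimes$ is the Kronecker product; $A_j=\mathrm{Mat}_j(\mathcal A)$, $G_j=\mathrm{Mat}_j(\mathcal G)$. $\mathbb O^{p\times r}$ is the set of $p\times r$ matrices with orthonormal columns; $\mathcal P_M$ is the orthogonal projection onto the column space of $M$; $\mathcal P_{U_\perp}=I-UU^\top$ for $U\in\mathbb O^{p\times r}$. The parameter space is $$\Theta=\Theta(\underline\lambda,\kappa)=\{\mathcal T=\mathcal G\times_1U_1\times_2U_2\times_3U_3:\ \mathcal G\in\mathbb R^{r_1\times r_2\times r_3},\ U_j\in\mathbb O^{p_j\times r_j},\ \underline\lambda\le\lambda\le\kappa\underline\lambda\},$$ where $\lambda$ ranges over all nonzero singular values of $\mathrm{Mat}_j(\mathcal T)$, $j=1,2,3$. $\mathcal I_\alpha(\Theta,\mathcal A)$ is the class of data-dependent intervals $\mathrm{CI}(\mathcal D)=[l(\mathcal D),u(\mathcal D)]$ with $\inf_{\mathcal T\in\Theta}\mathbb P_{\mathcal T}(l(\mathcal D)\le\langle\mathcal T,\mathcal A\rangle\le u(\mathcal D))\ge1-\alpha$. *)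

(* Defs.v *)
From HB Require Import structures.
From mathcomp Require Import all_boot all_order all_algebra.
From mathcomp Require Import mxtens.
From mathcomp Require Import all_classical all_reals all_analysis.

Set Implicit Arguments.
Unset Strict Implicit.
Unset Printing Implicit Defensive.

Import Order.TTheory GRing.Theory Num.Theory.
Local Open Scope classical_set_scope.
Local Open Scope ring_scope.

Definition tensor (R : Type) (p1 p2 p3 : nat) := 'I_p1 -> 'I_p2 -> 'I_p3 -> R.

HB.instance Definition _ (R : realType) p1 p2 p3 :=
  gen_eqMixin (tensor R p1 p2 p3).
HB.instance Definition _ (R : realType) p1 p2 p3 :=
  gen_choiceMixin (tensor R p1 p2 p3).
HB.instance Definition _ (R : realType) p1 p2 p3 :=
  isPointed.Build (tensor R p1 p2 p3) (fun _ _ _ => 0).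

Section tensor_algebra.
Variable R : realType.

(* [cyc] turns modes (1, 2, 3) into (2, 3, 1): mode indices being modulo 3,
   mode-2 and mode-3 operations are mode-1 operations up to [cyc]. *)
Definition cyc p1 p2 p3 (M : tensor R p1 p2 p3) : tensor R p2 p3 p1 :=
  fun k2 k3 k1 => M k1 k2 k3.

(* With indices starting from 0, column k2 + p2 * k3 holds the entries
   M k1 k2 k3; [mxtens_index (k3, k2)] has value k3 * p2 + k2, and the
   Kronecker product [*t] uses the same index convention. *)
Definition Mat1 p1 p2 p3 (M : tensor R p1 p2 p3) : 'M[R]_(p1, p3 * p2) :=
  \matrix_(k1, l) M k1 (mxtens_unindex l).2 (mxtens_unindex l).1.

Definition Mat2 p1 p2 p3 (M : tensor R p1 p2 p3) : 'M[R]_(p2, p1 * p3) :=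
  Mat1 (cyc M).

Definition Mat3 p1 p2 p3 (M : tensor R p1 p2 p3) : 'M[R]_(p3, p2 * p1) :=
  Mat1 (cyc (cyc M)).

Definition mode1 p1 p2 p3 q (M : tensor R p1 p2 p3) (V : 'M[R]_(q, p1)) :
  tensor R q p2 p3 := fun i k2 k3 => \sum_k1 V i k1 * M k1 k2 k3.

Definition mode2 p1 p2 p3 q (M : tensor R p1 p2 p3) (V : 'M[R]_(q, p2)) :
  tensor R p1 q p3 := fun k1 i k3 => \sum_k2 V i k2 * M k1 k2 k3.

Definition mode3 p1 p2 p3 q (M : tensor R p1 p2 p3) (V : 'M[R]_(q, p3)) :
  tensor R p1 p2 q := fun k1 k2 i => \sum_k3 V i k3 * M k1 k2 k3.

Definition mode123 p1 p2 p3 q1 q2 q3 (M : tensor R p1 p2 p3)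
    (V1 : 'M[R]_(q1, p1)) (V2 : 'M[R]_(q2, p2)) (V3 : 'M[R]_(q3, p3)) :
  tensor R q1 q2 q3 := mode3 (mode2 (mode1 M V1) V2) V3.

Definition tdot p1 p2 p3 (S M : tensor R p1 p2 p3) : R :=
  \sum_i \sum_j \sum_k S i j k * M i j k.

Definition tfrob p1 p2 p3 (M : tensor R p1 p2 p3) : R :=
  Num.sqrt (\sum_i \sum_j \sum_k M i j k ^+ 2).

Definition frob m n (M : 'M[R]_(m, n)) : R :=
  Num.sqrt (\sum_i \sum_j M i j ^+ 2).

Definition orthonormal_cols p r : set 'M[R]_(p, r) :=
  [set U | U^T *m U = 1%:M].

Definition perp_proj p r (U : 'M[R]_(p, r)) : 'M[R]_p := 1%:M - U *m U^T.

(* MathComp subspaces are row spaces: the column space of M is the row space of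
   M^T, and its orthogonal complement is the row space of [kermx M]. *)
Definition col_proj m n (M : 'M[R]_(m, n)) : 'M[R]_m :=
  proj_mx << M^T >>%MS (kermx M).

Definition nonzero_singular_value m n (M : 'M[R]_(m, n)) (s : R) : Prop :=
  0 < s /\ eigenvalue (M^T *m M) (s ^+ 2).

Definition Theta p1 p2 p3 r1 r2 r3 (lambda kappa : R) :
    set (tensor R p1 p2 p3) :=
  [set T | (exists G : tensor R r1 r2 r3,
            exists U1 : 'M[R]_(p1, r1), exists U2 : 'M[R]_(p2, r2),
            exists U3 : 'M[R]_(p3, r3),
              [/\ orthonormal_cols U1, orthonormal_cols U2,
                  orthonormal_cols U3 & T = mode123 G U1 U2 U3])
         /\ forall s : R,
              nonzero_singular_value (Mat1 T) s \/
              nonzero_singular_value (Mat2 T) s \/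
              nonzero_singular_value (Mat3 T) s ->
              lambda <= s <= kappa * lambda].

(* || P_{U_perp} B P_{V H^T} ||_F *)
Definition mode_term p r m n (U : 'M[R]_(p, r)) (B : 'M[R]_(p, m))
    (V : 'M[R]_(m, n)) (H : 'M[R]_(r, n)) : R :=
  frob (perp_proj U *m B *m col_proj (V *m H^T)).

Definition std_err p1 p2 p3 r1 r2 r3 (A : tensor R p1 p2 p3)
    (G : tensor R r1 r2 r3) (U1 : 'M[R]_(p1, r1)) (U2 : 'M[R]_(p2, r2))
    (U3 : 'M[R]_(p3, r3)) : R :=
  Num.sqrt (mode_term U1 (Mat1 A) (U3 *t U2) (Mat1 G) ^+ 2
          + mode_term U2 (Mat2 A) (U1 *t U3) (Mat2 G) ^+ 2
          + mode_term U3 (Mat3 A) (U2 *t U1) (Mat3 G) ^+ 2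
          + tfrob (mode123 A U1^T U2^T U3^T) ^+ 2).

End tensor_algebra.

Section confidence_intervals.
Context (R : realType) (p1 p2 p3 : nat).

(* The sigma-algebra of the sample space R^(p1 * p2 * p3), generated by the
   entries. *)
Definition cylinders : set (set (tensor R p1 p2 p3)) :=
  [set S | exists i j k (B : set R),
     measurable B /\ S = [set Y | B (Y i j k)]].

Definition measurable_stat (f : tensor R p1 p2 p3 -> R) : Prop :=
  measurable_fun [set: g_sigma_algebraType cylinders] f.

Context d (Om : measurableType d) (P : probability Om R).

Definition mutually_independent (I : finType) (X : I -> {RV P >-> R}) : Prop :=
  forall (J : {set I}) (B : I -> set R), (forall i, measurable (B i)) ->
    (P [set w | forall i, i \in J -> B i (X i w)]
     = \prod_(i in J) P (X i @^-1` B i))%E.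

Definition iid_normal (I : finType) (X : I -> {RV P >-> R}) (sigma : R) :
    Prop :=
  mutually_independent X /\
  forall i (B : set R), measurable B -> P (X i @^-1` B) = normal_prob 0 sigma B.

Variable Z : 'I_p1 * 'I_p2 * 'I_p3 -> {RV P >-> R}.

Definition obs (T : tensor R p1 p2 p3) (w : Om) : tensor R p1 p2 p3 :=
  fun i j k => T i j k + Z (i, j, k) w.

(* A data-dependent interval [l(Y), u(Y)] is the pair (l, u); it is not required
   that l <= u, the interval being empty, of length 0, where u < l. *)
Definition interval := ((tensor R p1 p2 p3 -> R) * (tensor R p1 p2 p3 -> R))%type.

Definition coverage (CI : interval) (A T : tensor R p1 p2 p3) : \bar R :=
  P [set w | CI.1 (obs T w) <= tdot T A <= CI.2 (obs T w)].

Definition CI_class (alpha : R) (Th : set (tensor R p1 p2 p3))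
    (A : tensor R p1 p2 p3) : set interval :=
  [set CI | [/\ measurable_stat CI.1, measurable_stat CI.2 &
     ((1 - alpha)%:E <= ereal_inf [set coverage CI A T | T in Th])%E]].

Definition length (CI : interval) (Y : tensor R p1 p2 p3) : R :=
  Num.max 0 (CI.2 Y - CI.1 Y).

Definition expected_length (CI : interval) (T : tensor R p1 p2 p3) : \bar R :=
  ('E_P[fun w => length CI (obs T w)])%E.

Definition minimax_length (alpha : R) (Th : set (tensor R p1 p2 p3))
    (A : tensor R p1 p2 p3) : \bar R :=
  ereal_inf [set ereal_sup [set expected_length CI T | T in Th]
            | CI in CI_class alpha Th A].

End confidence_intervals.

(* Main.v *)
Require Import Defs.
From mathcomp Require Import all_boot all_order all_algebra.
From mathcomp Require Import mxtens.
From mathcomp Require Import all_classical all_reals all_analysis.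
From mathcomp Require Import measurable_realfun.
From mathcomp Require Import ring lra.

(** The bound is a two-point argument inside [Theta].  If two signals [T] and
    [T + h] differ by a small enough multiple of [sigma] in Frobenius norm, the
    two laws of the observation nearly coincide, so an interval that covers the
    functional under both signals contains, with probability bounded below under
    [T], both values [<T, A>] and [<T + h, A>]; its expected length under [T] is
    then at least a constant times [|<h, A>|] ([two_point_minimax_length]).

    The supremum over [Theta] leaves the choice of [T] and [h] free; they need not
    be close to the given signal.  All three matricizations of an elementary
    tensor [s * (u (x) v (x) w)] with unit vectors have [s] as their only nonzero
    singular value, so that it lies in [Theta] for every choice of unit
    vectors once [lambda <= s <= kappa * lambda] ([rank1_Theta]).  Taking
    [s = lambda] for [T] and [s = lambda + delta * sigma] for [T + h], where
    [lambda >= rho * sigma] makes room for a constant [delta], gives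
    [<h, A> = delta * sigma * <u (x) v (x) w, A>].

    It remains to bound the standard error by the supremum of
    [<u (x) v (x) w, A>] over unit vectors, at the price of a factor that depends on
    the ranks ([rank1_bound_std_err]).  The entries of the core term are such
    values.  For the other terms, projecting the rows of [Mat1 A] onto a subspace of
    the column space of [U3 *t U2] gives at most the norm of [Mat1 A *m (U3 *t U2)],
    which has [r3 * r2] columns, each the contraction of [A] against a column of
    [U2] and one of [U3]; the norm of such a vector is again a supremum of values
    of this kind.

    The comparison of the two laws has to be free of the dimension.  By the
    Cameron-Martin formula ([obs_change_of_measure]) the law of [T + h + Z] has a
    density [L] with respect to that of [T + Z], and
    [E L^2 = exp (|h|^2 / sigma^2)] only involves the Frobenius norm of [h].
    Independence speaks of products of events, hence the formula is proved first
    on boxes, from the product rule for expectations ([expectation_prod]), and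
    extended by a pi-lambda argument. *)

Import Order.TTheory GRing.Theory Num.Theory.
Local Open Scope classical_set_scope.
Local Open Scope ring_scope.

Set Implicit Arguments.
Unset Strict Implicit.
Unset Printing Implicit Defensive.

(** * Frobenius norms and projections *)

Section matrix_norms.
Variable R : realType.

Lemma frob_sqrE m n (X : 'M[R]_(m, n)) : frob X ^+ 2 = \sum_i \sum_j X i j ^+ 2.
Proof.
by rewrite sqr_sqrtr// sumr_ge0// => i _; rewrite sumr_ge0// => j _; exact: sqr_ge0.
Qed.

Lemma frob_sqr_trace m n (X : 'M[R]_(m, n)) : frob X ^+ 2 = \tr (X^T *m X).
Proof.
rewrite frob_sqrE exchange_big/=; apply: eq_bigr => j _.
by rewrite mxE; apply: eq_bigr => i _; rewrite mxE expr2.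
Qed.

Lemma frob_sqr_rows m n (X : 'M[R]_(m, n)) :
  frob X ^+ 2 = \sum_i frob (row i X) ^+ 2.
Proof.
rewrite frob_sqrE; apply: eq_bigr => i _; rewrite frob_sqrE big_ord1.
by apply: eq_bigr => j _; rewrite mxE.
Qed.

Lemma frob_sqr_row n (x : 'rV[R]_n) : frob x ^+ 2 = (x *m x^T) 0 0.
Proof.
rewrite frob_sqrE big_ord1 mxE; apply: eq_bigr => j _.
by rewrite mxE expr2.
Qed.

Lemma frob_sqr_eq0 m n (X : 'M[R]_(m, n)) : frob X ^+ 2 = 0 -> X = 0.
Proof.
rewrite frob_sqrE => /eqP; rewrite psumr_eq0; last first.
  by move=> i _; rewrite sumr_ge0// => j _; exact: sqr_ge0.
move=> /allP X0; apply/matrixP => i j; rewrite mxE.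
have := X0 i (mem_index_enum _); rewrite psumr_eq0; last first.
  by move=> k _; exact: sqr_ge0.
by move=> /allP/(_ j (mem_index_enum _)); rewrite sqrf_eq0 => /eqP.
Qed.

Lemma frob_perp_proj_le p r n (U : 'M[R]_(p, r)) (Y : 'M[R]_(p, n)) :
  orthonormal_cols U -> frob (perp_proj U *m Y) ^+ 2 <= frob Y ^+ 2.
Proof.
rewrite /orthonormal_cols/= => UU.
rewrite -subr_ge0 !frob_sqr_trace -raddfB/=.
(* What is lost is the norm of [U^T *m Y], by Pythagoras. *)
suff -> : Y^T *m Y - (perp_proj U *m Y)^T *m (perp_proj U *m Y) =
    (U^T *m Y)^T *m (U^T *m Y) by rewrite -frob_sqr_trace sqr_ge0.
have PP : (perp_proj U)^T *m perp_proj U = perp_proj U.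
  have -> : (perp_proj U)^T = perp_proj U.
    by rewrite /perp_proj [LHS]raddfB/= trmx1 trmx_mul trmxK.
  rewrite /perp_proj mulmxBl !mulmxBr !mul1mx !mulmx1.
  by rewrite mulmxA -(mulmxA U _ U) UU mulmx1 subrr subr0.
rewrite trmx_mul mulmxA -(mulmxA Y^T) PP /perp_proj.
by rewrite mulmxBr mulmxBl mulmx1 subKr trmx_mul trmxK !mulmxA.
Qed.

(** Over an ordered field the column space of [N] and the kernel of [N^T] meet
    only in 0 and hence span the whole space by a dimension count, so that
    [col_proj N], defined from an arbitrary pair of subspaces, really is the
    orthogonal projection. *)
Lemma col_proj_decomp m n (N : 'M[R]_(m, n)) (x : 'rV[R]_m) :
  (x *m col_proj N <= N^T)%MS /\ (x - x *m col_proj N) *m N = 0.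
Proof.
have cap0 : (<<N^T>> :&: kermx N = 0)%MS.
  apply/eqP/rowV0P => y; rewrite sub_capmx genmxE => /andP[/submxP[z yE] yN].
  apply: frob_sqr_eq0; rewrite frob_sqr_row {1}yE -mulmxA -trmx_mul.
  by rewrite (sub_kermxP yN) trmx0 mulmx0 mxE.
have full : (x <= <<N^T>> + kermx N)%MS.
  apply: submx_full; rewrite /row_full.
  have /mxrank_disjoint_sum -> := cap0.
  by rewrite genmxE mxrank_tr mxrank_ker subnKC// rank_leq_row.
split; first by rewrite -(genmxE N^T) proj_mx_sub.
by apply/sub_kermxP; exact: proj_mx_compl_sub.
Qed.

(** The projection onto a subspace of the column space of [V] factors through the
    projection onto that space, and multiplying by [V] computes the coordinates of
    the latter in an orthonormal basis. *)
Lemma frob_col_proj_le m n r (X : 'M[R]_(m, n)) (V : 'M[R]_(n, r)) k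
    (K : 'M[R]_(r, k)) : orthonormal_cols V ->
  frob (X *m col_proj (V *m K)) ^+ 2 <= frob (X *m V) ^+ 2.
Proof.
rewrite /orthonormal_cols/= => VV; rewrite !frob_sqr_rows; apply: ler_sum => i _.
rewrite !row_mul; set x := row i X; set N := V *m K.
have [/submxP[y xQ] zN] := col_proj_decomp N x.
pose a := y *m K^T; pose b := x *m V.
(* With [a] the coordinates of the projection of [x] and [b] those of [x]
   itself, [a a^T = a b^T], so that [b b^T - a a^T] is the square of [b - a]. *)
have aa : (x *m col_proj N) *m (x *m col_proj N)^T = a *m a^T.
  rewrite xQ /N /a !trmx_mul !trmxK -!mulmxA (mulmxA V^T) VV mul1mx.
  by rewrite !mulmxA.
have ab : (x *m col_proj N) *m (x *m col_proj N)^T = a *m b^T.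
  rewrite {1}xQ -mulmxA -trmx_mul.
  have -> : x *m col_proj N *m N = x *m N.
    by apply/esym/eqP; rewrite -subr_eq0 -mulmxBl zN.
  by rewrite /a /b /N !trmx_mul !mulmxA.
rewrite -subr_ge0; have : 0 <= frob (b - a) ^+ 2 by exact: sqr_ge0.
rewrite !frob_sqr_row aa.
have ba : b *m a^T = a *m a^T.
  by rewrite -[LHS]trmxK trmx_mul trmxK -ab aa trmx_mul trmxK.
rewrite [(b - a)^T]raddfB/= mulmxBr !mulmxBl ba -ab aa subrr subr0.
by rewrite [X in 0 <= X -> _]mxE [X in 0 <= _ + X -> _]mxE.
Qed.

(** The hypothesis on [b] is only asked for when [r] is nonzero: for [r = 0] the
    projection is zero whatever [B] is. *)
Lemma mode_term_sqr_le p r m n (U : 'M[R]_(p, r)) (B : 'M[R]_(p, m))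
    (V : 'M[R]_(m, n)) (H : 'M[R]_(r, n)) (b : R) :
  orthonormal_cols U -> orthonormal_cols V -> 0 <= b ->
  ('I_r -> frob (B *m V) ^+ 2 <= b) -> mode_term U B V H ^+ 2 <= b.
Proof.
move=> oU oV b0; case: r U H oU => [|r] U H oU BVb; last first.
  apply: le_trans (BVb ord0); apply: le_trans (frob_col_proj_le _ _ oV) _.
  by rewrite -mulmxA frob_perp_proj_le.
rewrite /mode_term frob_sqr_rows big1// => i _.
have [/submxP[y + _]] := col_proj_decomp (V *m H^T) (row i (perp_proj U *m B)).
by rewrite !row_mul => ->; rewrite (thinmx0 y) mul0mx frob_sqr_row mul0mx mxE.
Qed.

End matrix_norms.

(** * Elementary tensors in the parameter space *)

Section rank_one_tensors.
Variable R : realType.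

(** The elementary tensor [s * (u (x) v (x) w)].  Vectors are one-column matrices, so
    that [orthonormal_cols] also says that a vector has norm one. *)
Definition rank1 (s : R) p1 p2 p3 (u : 'cV[R]_p1) (v : 'cV[R]_p2)
    (w : 'cV[R]_p3) : tensor R p1 p2 p3 :=
  fun i j k => s * (u i 0 * v j 0 * w k 0).

Lemma orthonormal_colP p (u : 'cV[R]_p) :
  orthonormal_cols u <-> \sum_i u i 0 ^+ 2 = 1.
Proof.
have uu : (u^T *m u) 0 0 = \sum_i u i 0 ^+ 2.
  by rewrite mxE; apply: eq_bigr => i _; rewrite mxE expr2.
split => [|u1]; first by rewrite -uu => ->; rewrite mxE eqxx.
by rewrite /orthonormal_cols/= [LHS]mx11_scalar uu u1.
Qed.

Lemma orthonormal_col p r (U : 'M[R]_(p, r)) e :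
  orthonormal_cols U -> orthonormal_cols (col e U).
Proof.
move=> UU; apply/orthonormal_colP.
have := congr1 (fun M : 'M[R]_r => M e e) UU; rewrite !mxE eqxx mulr1n => <-.
by apply: eq_bigr => i _; rewrite !mxE expr2.
Qed.

(** Any unit vector can be made a column of a frame of given size: apply to the
    frame [U] the Householder reflection that exchanges [u] with a column of [U]. *)
Lemma orthonormal_cols_with_col p r (U : 'M[R]_(p, r)) (e : 'I_r) (u : 'cV[R]_p) :
  orthonormal_cols U -> orthonormal_cols u ->
  exists2 V : 'M[R]_(p, r), orthonormal_cols V & col e V = u.
Proof.
move=> UU uu; pose v := col e U.
have vv : orthonormal_cols v by exact: orthonormal_col.
have [uv|uv] := eqVneq u v; first by exists U.
rewrite /orthonormal_cols/= in UU uu vv *.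
pose w := u - v; pose c := (w^T *m w) 0 0.
have wwE : w^T *m w = c%:M by rewrite [LHS]mx11_scalar.
have c0 : c != 0.
  apply: contra_neq uv => c0; apply/eqP; rewrite -subr_eq0; apply/eqP.
  by apply: frob_sqr_eq0; rewrite frob_sqr_trace wwE c0 raddf0 mxtrace0.
pose H : 'M[R]_p := 1%:M - (2 / c) *: (w *m w^T).
have HT : H^T = H.
  by rewrite /H [LHS]raddfB/= trmx1 [(_ *: _)^T]linearZ/= trmx_mul trmxK.
have HH : H *m H = 1%:M.
  rewrite /H mulmxBl !mulmxBr !mul1mx mulmx1 -scalemxAl -scalemxAr.
  rewrite mulmxA -(mulmxA w) wwE mul_mx_scalar -scalemxAl !scalerA.
  apply/matrixP => i j; rewrite !mxE; field. exact: c0.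
exists (H *m U).
  by rewrite /orthonormal_cols/= trmx_mul HT mulmxA -(mulmxA U^T) HH mulmx1.
have -> : col e (H *m U) = H *m v.
  by apply/matrixP => i j; rewrite !mxE; apply: eq_bigr => k _; rewrite !mxE.
have wv : w^T *m v = (- (c / 2))%:M.
  have uvT : v^T *m u = u^T *m v.
    by apply/matrixP => a b; rewrite !ord1 !mxE; apply: eq_bigr => k _;
      rewrite !mxE mulrC.
  have : c%:M = 1%:M - u^T *m v - (u^T *m v - 1%:M).
    rewrite -wwE /w [(u - v)^T]raddfB/= mulmxBl !mulmxBr uu vv uvT. by [].
  rewrite /w [(u - v)^T]raddfB/= mulmxBl vv.
  rewrite [u^T *m v]mx11_scalar; set t := (_ *m _) 0 0.
  move=> /matrixP/(_ 0 0); rewrite !mxE eqxx !mulr1n => ->.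
  apply/matrixP => i j; rewrite !mxE !ord1 eqxx !mulr1n; lra.
rewrite /H mulmxBl mul1mx -scalemxAl -mulmxA wv mul_mx_scalar scalerA.
have -> : 2 / c * - (c / 2) = -1 by field.
by rewrite scaleN1r opprK /w addrC subrK.
Qed.

Lemma mode123_rank1 (s : R) p1 p2 p3 q1 q2 q3 (u : 'cV[R]_p1) (v : 'cV[R]_p2)
    (w : 'cV[R]_p3) (V1 : 'M[R]_(q1, p1)) (V2 : 'M[R]_(q2, p2))
    (V3 : 'M[R]_(q3, p3)) :
  mode123 (rank1 s u v w) V1 V2 V3 = rank1 s (V1 *m u) (V2 *m v) (V3 *m w).
Proof.
have m1 : mode1 (rank1 s u v w) V1 = rank1 s (V1 *m u) v w.
  apply/funext => i; apply/funext => j; apply/funext => k.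
  rewrite /mode1 /rank1 mxE !mulr_suml mulr_sumr.
  by apply: eq_bigr => l _; ring.
rewrite /mode123 m1.
have m2 : mode2 (rank1 s (V1 *m u) v w) V2 = rank1 s (V1 *m u) (V2 *m v) w.
  apply/funext => i; apply/funext => j; apply/funext => k.
  rewrite /mode2 /rank1 [in RHS](mxE _ _ j) mulr_sumr mulr_suml mulr_sumr.
  by apply: eq_bigr => l _; ring.
rewrite m2.
apply/funext => i; apply/funext => j; apply/funext => k.
rewrite /mode3 /rank1 [in RHS](mxE _ _ k) !mulr_sumr.
by apply: eq_bigr => l _; ring.
Qed.

Lemma cyc_rank1 s p1 p2 p3 (u : 'cV[R]_p1) (v : 'cV[R]_p2) (w : 'cV[R]_p3) :
  cyc (rank1 s u v w) = rank1 s v w u.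
Proof.
apply/funext => i; apply/funext => j; apply/funext => k.
by rewrite /cyc /rank1; ring.
Qed.

(** With [x] the unit vector [w (x) v], the Gram matrix of the matricization is
    [s ^ 2 x x^T], whose only nonzero eigenvalue is [s ^ 2]. *)
Lemma singular_value_rank1 s t p1 p2 p3 (u : 'cV[R]_p1) (v : 'cV[R]_p2)
    (w : 'cV[R]_p3) :
  orthonormal_cols u -> orthonormal_cols v -> orthonormal_cols w -> 0 < s ->
  nonzero_singular_value (Mat1 (rank1 s u v w)) t -> t = s.
Proof.
move=> uu /orthonormal_colP vv /orthonormal_colP ww s0 [t0 /eigenvalueP[y yE y0]].
pose x : 'cV[R]_(p3 * p2) :=
  \col_l (v (mxtens_unindex l).2 0 * w (mxtens_unindex l).1 0).
have xx : x^T *m x = 1%:M.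
  apply/orthonormal_colP; transitivity ((\sum_i w i 0 ^+ 2) * \sum_i v i 0 ^+ 2).
    rewrite mulr_sum; apply: eq_bigr => l _.
    by rewrite mxE exprMn mulrC.
  by rewrite vv ww mulr1.
have ME : Mat1 (rank1 s u v w) = s *: (u *m x^T).
  by apply/matrixP => i l; rewrite !mxE big_ord1 !mxE /rank1 !mulrA.
have MM : (Mat1 (rank1 s u v w))^T *m Mat1 (rank1 s u v w) =
    s ^+ 2 *: (x *m x^T).
  rewrite ME [(_ *: _)^T]linearZ/= -scalemxAl -scalemxAr scalerA trmx_mul trmxK.
  by rewrite mulmxA -(mulmxA x) uu mulmx1 expr2.
have yx : s ^+ 2 *: (y *m x) = t ^+ 2 *: (y *m x).
  rewrite [in RHS]scalemxAl -yE MM -scalemxAr -scalemxAl.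
  by rewrite -!mulmxA xx mulmx1.
have yx0 : y *m x != 0.
  apply: contra_neq y0 => yx0.
  have : t ^+ 2 *: y = 0 by rewrite -yE MM -scalemxAr mulmxA yx0 mul0mx scaler0.
  by move=> /eqP; rewrite scaler_eq0 sqrf_eq0 gt_eqF//= => /eqP.
apply/eqP; rewrite -(eqrXn2 (n := 2))// ?ltW//; apply/eqP.
apply/eqP; rewrite -subr_eq0; have /eqP := yx; rewrite eq_sym -subr_eq0 -scalerBl.
by rewrite scaler_eq0 (negPf yx0) orbF.
Qed.

(** The constraint on singular values only sees [s].  The frames [U1], [U2], [U3]
    and the indices [e1], [e2], [e3] merely witness [0 < r_j <= p_j], without which
    [Theta] contains no nonzero tensor. *)
Lemma rank1_Theta p1 p2 p3 r1 r2 r3 (lambda kappa s : R)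
    (U1 : 'M[R]_(p1, r1)) (U2 : 'M[R]_(p2, r2)) (U3 : 'M[R]_(p3, r3))
    (e1 : 'I_r1) (e2 : 'I_r2) (e3 : 'I_r3)
    (u : 'cV[R]_p1) (v : 'cV[R]_p2) (w : 'cV[R]_p3) :
  orthonormal_cols U1 -> orthonormal_cols U2 -> orthonormal_cols U3 ->
  orthonormal_cols u -> orthonormal_cols v -> orthonormal_cols w ->
  0 < s -> lambda <= s <= kappa * lambda ->
  Theta r1 r2 r3 lambda kappa (rank1 s u v w).
Proof.
move=> oU1 oU2 oU3 ou ov ow s0 s_bnd; split; last first.
  move=> t [|[]].
  - by move=> /singular_value_rank1 ->.
  - by rewrite /Mat2 cyc_rank1 => /singular_value_rank1 ->.
  - by rewrite /Mat3 !cyc_rank1 => /singular_value_rank1 ->.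
have [V1 oV1 V1u] := orthonormal_cols_with_col e1 oU1 ou.
have [V2 oV2 V2v] := orthonormal_cols_with_col e2 oU2 ov.
have [V3 oV3 V3w] := orthonormal_cols_with_col e3 oU3 ow.
exists (rank1 s (delta_mx e1 0) (delta_mx e2 0) (delta_mx e3 0)), V1, V2, V3.
by split => //; rewrite mode123_rank1 -!colE V1u V2v V3w.
Qed.

End rank_one_tensors.

(** * The standard error and elementary tensors *)

Section rank_one_functional.
Variable R : realType.

Lemma tensmx_orthonormal p q m n (V : 'M[R]_(p, q)) (W : 'M[R]_(m, n)) :
  orthonormal_cols V -> orthonormal_cols W -> orthonormal_cols (V *t W).
Proof.
rewrite /orthonormal_cols/= trmx_tens tensmx_mul => -> ->.
apply/matrixP => i j.
case: (mxtens_indexP i) => i1 i2; case: (mxtens_indexP j) => j1 j2.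
rewrite tensmxE !mxE (can_eq (@mxtens_indexK q n)) xpair_eqE.
by rewrite -mulnb natrM.
Qed.

(** The case of equality in Cauchy-Schwarz: test the bound on [a / |a|]. *)
Lemma unit_functional_bound p (a : 'cV[R]_p) (b : R) : 0 <= b ->
  (forall u : 'cV[R]_p, orthonormal_cols u -> \sum_i u i 0 * a i 0 <= b) ->
  \sum_i a i 0 ^+ 2 <= b ^+ 2.
Proof.
move=> b0 ab; have [->|a0] := eqVneq (\sum_i a i 0 ^+ 2) 0; first exact: sqr_ge0.
set t := \sum_i _ in a0 *.
have t0 : 0 < t by rewrite lt_neqAle eq_sym a0 sumr_ge0// => i _; exact: sqr_ge0.
have st0 : 0 < Num.sqrt t by rewrite sqrtr_gt0.
have := ab ((Num.sqrt t)^-1 *: a).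
have -> : \sum_i ((Num.sqrt t)^-1 *: a) i 0 * a i 0 = Num.sqrt t.
  under eq_bigr do rewrite mxE -mulrA -expr2.
  by rewrite -mulr_sumr -/t -[X in _ * X]sqr_sqrtr ?ltW// expr2 mulKf// gt_eqF.
have o : orthonormal_cols ((Num.sqrt t)^-1 *: a).
  apply/orthonormal_colP; under eq_bigr do rewrite mxE exprMn.
  by rewrite -mulr_sumr -/t exprVn sqr_sqrtr ?ltW// mulVf.
by move=> /(_ o) stb; rewrite -(sqr_sqrtr (ltW t0)) ler_pXn2r// nnegrE ?ltW.
Qed.

Lemma tdot_rank1 s p1 p2 p3 (u : 'cV[R]_p1) (v : 'cV[R]_p2) (w : 'cV[R]_p3) A :
  tdot (rank1 s u v w) A = s * tdot (rank1 1 u v w) A.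
Proof.
rewrite /tdot mulr_sumr; apply: eq_bigr => i _; rewrite mulr_sumr.
apply: eq_bigr => j _; rewrite mulr_sumr; apply: eq_bigr => k _.
by rewrite /rank1; ring.
Qed.

Lemma tdot_cyc p1 p2 p3 (S A : tensor R p1 p2 p3) :
  tdot (cyc S) (cyc A) = tdot S A.
Proof.
rewrite /tdot [RHS]exchange_big/=; apply: eq_bigr => j _.
by rewrite exchange_big.
Qed.

(** [b] is at least the spectral (injective) norm of [A]. *)
Definition rank1_bound p1 p2 p3 (A : tensor R p1 p2 p3) (b : R) :=
  forall (u : 'cV[R]_p1) (v : 'cV[R]_p2) (w : 'cV[R]_p3),
    orthonormal_cols u -> orthonormal_cols v -> orthonormal_cols w ->
    tdot (rank1 1 u v w) A <= b.

Lemma rank1_bound_cyc p1 p2 p3 (A : tensor R p1 p2 p3) b :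
  rank1_bound A b -> rank1_bound (cyc A) b.
Proof.
by move=> Ab v w u ov ow ou; rewrite -(cyc_rank1 1 u v w) tdot_cyc; exact: Ab.
Qed.

(** Each of the [r3 * r2] columns of the product is the contraction of [A] against
    a column of [U2] and a column of [U3], and is tested against unit vectors. *)
Lemma rank1_bound_Mat1 p1 p2 p3 r2 r3 (A : tensor R p1 p2 p3) b
    (U2 : 'M[R]_(p2, r2)) (U3 : 'M[R]_(p3, r3)) :
  0 <= b -> orthonormal_cols U2 -> orthonormal_cols U3 ->
  ('I_r2 -> 'I_r3 -> rank1_bound A b) ->
  frob (Mat1 A *m (U3 *t U2)) ^+ 2 <= (r3 * r2)%:R * b ^+ 2.
Proof.
move=> b0 o2 o3 Ab; rewrite frob_sqrE exchange_big/=.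
rewrite -[X in X%:R * _]card_ord -sum1_card natr_sum mulr_suml.
apply: ler_sum => l _; rewrite mul1r; case: (mxtens_indexP l) => c e.
pose a := col (mxtens_index (c, e)) (Mat1 A *m (U3 *t U2)).
rewrite (eq_bigr (fun i => a i 0 ^+ 2)); last by move=> i _; rewrite [a i 0]mxE.
apply: unit_functional_bound => // u ou.
have := Ab e c _ _ _ ou (orthonormal_col e o2) (orthonormal_col c o3).
congr (_ <= _); rewrite /tdot; apply: eq_bigr => i _.
rewrite !mxE mulr_sumr (reindex (@mxtens_index p3 p2)); last first.
  exists (@mxtens_unindex p3 p2) => ? _; first exact: mxtens_indexK.
  exact: mxtens_unindexK.
rewrite [LHS]exchange_big/= pair_big/=; apply: eq_bigr => -[k j] _ /=.
by rewrite tensmxE !mxE mxtens_indexK /rank1 !mxE/=; ring.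
Qed.

Lemma rank1_bound_core p1 p2 p3 r1 r2 r3 (A : tensor R p1 p2 p3) b
    (U1 : 'M[R]_(p1, r1)) (U2 : 'M[R]_(p2, r2)) (U3 : 'M[R]_(p3, r3)) :
  0 <= b -> orthonormal_cols U1 -> orthonormal_cols U2 -> orthonormal_cols U3 ->
  ('I_r1 -> 'I_r2 -> 'I_r3 -> rank1_bound A b) ->
  tfrob (mode123 A U1^T U2^T U3^T) ^+ 2 <= (r1 * r2 * r3)%:R * b ^+ 2.
Proof.
move=> b0 o1 o2 o3 Ab.
rewrite sqr_sqrtr; last first.
  rewrite sumr_ge0// => i _; rewrite sumr_ge0// => j _.
  by rewrite sumr_ge0// => k _; exact: sqr_ge0.
have entry_le i j k : mode123 A U1^T U2^T U3^T i j k ^+ 2 <= b ^+ 2.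
  have E : mode123 A U1^T U2^T U3^T i j k =
      tdot (rank1 1 (col i U1) (col j U2) (col k U3)) A.
    rewrite /mode123 /mode3 /mode2 /mode1 /tdot.
    under eq_bigr => c _.
      by rewrite mulr_sumr; under eq_bigr => b' _ do rewrite !mulr_sumr; over.
    rewrite exchange_big/=; under eq_bigr do rewrite exchange_big/=.
    rewrite exchange_big/=; apply: eq_bigr => x _; apply: eq_bigr => y _.
    by apply: eq_bigr => z _; rewrite /rank1 !mxE; ring.
  (* A sign change of one vector turns the upper bound into a two-sided one. *)
  have oN : orthonormal_cols (- col i U1).
    apply/orthonormal_colP; under eq_bigr do rewrite mxE sqrrN.
    by apply/orthonormal_colP; exact: orthonormal_col.
  have := Ab i j k _ _ _ oN (orthonormal_col j o2) (orthonormal_col k o3).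
  have -> : tdot (rank1 1 (- col i U1) (col j U2) (col k U3)) A =
      - mode123 A U1^T U2^T U3^T i j k.
    rewrite E -mulN1r -tdot_rank1; congr tdot.
    by do 3 apply/funext => ?; rewrite /rank1 !mxE; ring.
  have := Ab i j k _ _ _ (orthonormal_col i o1) (orthonormal_col j o2)
    (orthonormal_col k o3).
  rewrite -E => ? ?; rewrite -(real_normK (num_real (mode123 _ _ _ _ _ _ _))).
  by rewrite ler_pXn2r// ?nnegrE// ler_norml; apply/andP; split; lra.
apply: (@le_trans _ _ (\sum_(i < r1) \sum_(j < r2) \sum_(k < r3) b ^+ 2)).
  by apply: ler_sum => i _; apply: ler_sum => j _; exact: ler_sum.
rewrite !sumr_const !card_ord -!mulrnA mulr_natl.
by rewrite (_ : (r3 * (r2 * r1))%N = (r1 * r2 * r3)%N)//; ring.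
Qed.

(** The bound is only required when all three ranks are nonzero, since otherwise
    the standard error vanishes.  The terms of modes 2 and 3 are that of mode 1
    for a cyclic shift of the tensor. *)
Lemma rank1_bound_std_err p1 p2 p3 r1 r2 r3 (A : tensor R p1 p2 p3) b
    (G : tensor R r1 r2 r3)
    (U1 : 'M[R]_(p1, r1)) (U2 : 'M[R]_(p2, r2)) (U3 : 'M[R]_(p3, r3)) :
  0 <= b -> orthonormal_cols U1 -> orthonormal_cols U2 -> orthonormal_cols U3 ->
  ('I_r1 -> 'I_r2 -> 'I_r3 -> rank1_bound A b) ->
  std_err A G U1 U2 U3 <=
    Num.sqrt (r3 * r2 + r1 * r3 + r2 * r1 + r1 * r2 * r3)%:R * b.
Proof.
move=> b0 o1 o2 o3 Ab.
pose N n : R := n%:R * b ^+ 2.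
have N0 n : 0 <= N n by rewrite mulr_ge0// sqr_ge0.
have t1 : mode_term U1 (Mat1 A) (U3 *t U2) (Mat1 G) ^+ 2 <= N (r3 * r2)%N.
  apply: mode_term_sqr_le => // [|e1]; first exact: tensmx_orthonormal.
  by apply: rank1_bound_Mat1 => // e2 e3; exact: Ab.
have t2 : mode_term U2 (Mat2 A) (U1 *t U3) (Mat2 G) ^+ 2 <= N (r1 * r3)%N.
  apply: mode_term_sqr_le => // [|e2]; first exact: tensmx_orthonormal.
  by apply: rank1_bound_Mat1 => // e3 e1; apply: rank1_bound_cyc; exact: Ab.
have t3 : mode_term U3 (Mat3 A) (U2 *t U1) (Mat3 G) ^+ 2 <= N (r2 * r1)%N.
  apply: mode_term_sqr_le => // [|e3]; first exact: tensmx_orthonormal.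
  apply: rank1_bound_Mat1 => // e1 e2.
  by do 2 apply: rank1_bound_cyc; exact: Ab.
have t4 := rank1_bound_core b0 o1 o2 o3 Ab.
rewrite -[X in _ * X](ger0_norm b0) -sqrtr_sqr -sqrtrM//.
apply: ler_wsqrtr.
by rewrite !natrD !mulrDl; apply: lerD => //; apply: lerD => //; exact: lerD.
Qed.

End rank_one_functional.

(** * Integrals determined by a weighted image measure *)

Section weighted_integral.
Context d (T : measurableType d) d' (Y : measurableType d') (R : realType).
Variables (mu : {measure set T -> \bar R}) (X : T -> Y) (xi : T -> R).
Hypotheses (mX : measurable_fun setT X) (mxi : measurable_fun setT xi).
Hypothesis xi_ge0 : forall t, 0 <= xi t.
Import HBNNSimple.

Lemma weighted_integral_nnsfun (g : {nnsfun Y >-> R}) :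
  (\int[mu]_t (g (X t) * xi t)%:E =
   \sum_(y \in range g)
     y%:E * \int[mu]_(t in X @^-1` (g @^-1` [set y])) (xi t)%:E)%E.
Proof.
have mgX y : measurable (X @^-1` (g @^-1` [set y])).
  by rewrite -[X in measurable X]setTI; exact: mX.
have indic_xi y t : (\1_(g @^-1` [set y]) (X t) * xi t)%:E =
    ((fun t => (xi t)%:E) \_ (X @^-1` (g @^-1` [set y]))) t.
  rewrite /= patchE indicE; case: ifPn => tgy.
    by rewrite mem_set ?mul1r//; rewrite inE in tgy.
  by rewrite memNset ?mul0r//; rewrite notin_setE in tgy.
have mterm y : measurable_fun setT (fun t => \1_(g @^-1` [set y]) (X t) * xi t).
  by apply: measurable_funM => //; apply: measurableT_comp.
have term_ge0 y t : 0 <= \1_(g @^-1` [set y]) (X t) * xi t.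
  by rewrite mulr_ge0.
rewrite (eq_integral (fun t => \sum_(y \in range g)
    (y * (\1_(g @^-1` [set y]) (X t) * xi t))%:E)%E); last first.
  move=> t _; rewrite fsumEFin// fimfunE; congr _%:E.
  rewrite !fsbig_finite//= big_distrl/=.
  by apply: eq_bigr => y _; rewrite mulrA.
rewrite ge0_integral_fsum//; last 2 first.
- by move=> y; apply/measurable_EFinP; exact: measurable_funM.
- move=> y t _; rewrite lee_fin mulrA mulr_ge0// -lee_fin EFinM.
  exact: nnfun_muleindic_ge0.
apply: eq_fsbigr => y _; have [y0|y0] := leP 0 y.
  under eq_integral do rewrite EFinM.
  rewrite ge0_integralZl_EFin//; last 2 first.
  - by move=> t _; rewrite lee_fin.
  - exact/measurable_EFinP.
  congr (_ * _)%E; rewrite [RHS]integral_mkcond.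
  by apply: eq_integral => t _; exact: indic_xi.
rewrite preimage_nnfun0// preimage_set0 integral_set0 mule0.
by apply: integral0_eq => t _; rewrite indicE in_set0 mul0r mulr0.
Qed.

Lemma weighted_integral_approx (g : Y -> R)
    (mg : measurable_fun setT (EFin \o g)) :
  (forall y, 0 <= g y) ->
  (\int[mu]_t (g (X t) * xi t)%:E =
   limn (fun n => \int[mu]_t (nnsfun_approx measurableT mg n (X t) * xi t)%:E))%E.
Proof.
move=> g_ge0; rewrite -monotone_convergence//.
- apply: eq_integral => t _; apply/esym/cvg_lim => //.
  under eq_fun do rewrite EFinM.
  rewrite EFinM; apply: cvgeZr => //.
  by apply: cvg_nnsfun_approx => // y _; rewrite lee_fin.
- move=> n; apply/measurable_EFinP/measurable_funM => //.
  exact: measurableT_comp.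
- by move=> n t _; rewrite lee_fin mulr_ge0.
- move=> t _ m n mn; rewrite lee_fin ler_wpM2r//.
  exact/lefP/nd_nnsfun_approx.
Qed.

End weighted_integral.

Section eq_weighted_integral.
Import HBNNSimple.

(** Both integrals are integrals of [g] against the image under [X] of the measure
    with density [xi]; simple functions only see the values of that image measure on
    measurable sets.  Instances used below are the product rule for independent
    variables and the integration of a function of a variable of known density. *)
Lemma eq_weighted_integral (R : realType) d' (Y : measurableType d')
    d1 (T1 : measurableType d1) (mu1 : {measure set T1 -> \bar R})
    (X1 : T1 -> Y) (xi1 : T1 -> R)
    d2 (T2 : measurableType d2) (mu2 : {measure set T2 -> \bar R})
    (X2 : T2 -> Y) (xi2 : T2 -> R) (g : Y -> R) :
  measurable_fun setT X1 -> measurable_fun setT xi1 -> (forall t, 0 <= xi1 t) ->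
  measurable_fun setT X2 -> measurable_fun setT xi2 -> (forall t, 0 <= xi2 t) ->
  (forall B, measurable B ->
    \int[mu1]_(t in X1 @^-1` B) (xi1 t)%:E =
    \int[mu2]_(t in X2 @^-1` B) (xi2 t)%:E)%E ->
  measurable_fun setT g -> (forall y, 0 <= g y) ->
  (\int[mu1]_t (g (X1 t) * xi1 t)%:E = \int[mu2]_t (g (X2 t) * xi2 t)%:E)%E.
Proof.
move=> mX1 mxi1 xi1_ge0 mX2 mxi2 xi2_ge0 eq12 /measurable_EFinP mg g_ge0.
rewrite (weighted_integral_approx mu1 mX1 mxi1 xi1_ge0 mg g_ge0).
rewrite (weighted_integral_approx mu2 mX2 mxi2 xi2_ge0 mg g_ge0).
congr (limn _); apply/funext => n.
rewrite (weighted_integral_nnsfun mu1 mX1 mxi1 xi1_ge0).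
rewrite (weighted_integral_nnsfun mu2 mX2 mxi2 xi2_ge0).
apply: eq_fsbigr => y _; rewrite eq12//; exact: measurable_funPTI.
Qed.

End eq_weighted_integral.

(** * Expectations of products of independent variables *)

Section product_formula.
Context d (Om : measurableType d) (R : realType) (P : probability Om R).
Context (I : finType) (X : I -> {RV P >-> R}).
Hypothesis indepX : mutually_independent X.

Lemma integral_indic_RV (i : I) (B : set R) : measurable B ->
  (\int[P]_w (\1_B (X i w))%:E = P (X i @^-1` B))%E.
Proof.
move=> mB; rewrite -[X in P X]setIT -integral_indic//.
by rewrite -[X in measurable X]setTI; exact: measurable_funP.
Qed.

(** Independence is the case where all [g i] are indicators; the indicators are
    replaced by arbitrary functions one index at a time, along [s].  Finiteness of
    the expectations makes the product over the remaining indices a real weight. *)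
Lemma expectation_prod_seq (s : seq I) (g : I -> R -> R) :
  (forall i, measurable_fun setT (g i)) -> (forall i x, 0 <= g i x) ->
  (forall i, (\int[P]_w (g i (X i w))%:E < +oo)%E) ->
  (forall i, i \notin s -> exists B, measurable B /\ g i = \1_B) ->
  (\int[P]_w (\prod_i g i (X i w))%:E = \prod_i \int[P]_w (g i (X i w))%:E)%E.
Proof.
elim: s g => [|k s IHs] g mg g_ge0 g_fin g_indic.
  have /choice[B gB] i : exists B, measurable B /\ g i = \1_B.
    exact: g_indic.
  have mB i : measurable (B i) by case: (gB i).
  have {gB} gB i : g i = \1_(B i) by case: (gB i).
  under [RHS]eq_bigr do rewrite gB integral_indic_RV//.
  have := indepX [set: I]%SET mB.
  rewrite [in X in _ = X -> _](eq_bigl xpredT); last first.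
    by move=> i; rewrite finset.in_setT.
  move=> <-; set D := [set w | _].
  have mD : measurable D.
    rewrite (_ : D = \bigcap_(i in [set: I]) (X i @^-1` B i)); last first.
      by apply/seteqP; split => w /= Dw i _; apply: Dw; rewrite ?finset.in_setT.
    apply: fin_bigcap_measurable => // i _.
    exact: measurable_funPTI.
  rewrite -[X in P X]setIT -integral_indic//.
  apply: eq_integral => w _; congr _%:E; rewrite [RHS]indicE.
  case: (boolP (w \in D)) => [|]; rewrite ?inE ?notin_setE => Dw.
    rewrite big1// => i _; rewrite gB indicE mem_set//.
    by apply: Dw; rewrite finset.in_setT.
  have [i nBi] : exists i, ~ B i (X i w).
    by apply/existsNP => allB; apply: Dw => i _.
  by rewrite (bigD1 i)//= gB indicE memNset// mul0r.
have mgX i : measurable_fun setT (fun w => g i (X i w)).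
  by apply: measurableT_comp.
pose xi w := \prod_(i | i != k) g i (X i w).
have mxi : measurable_fun setT xi.
  rewrite (_ : xi = fun w => \prod_(i <- enum [pred i | i != k]) g i (X i w)).
    exact: measurable_prod.
  by apply/funext => w; rewrite /xi big_enum.
have xi_ge0 w : 0 <= xi w by apply: prodr_ge0.
pose c := fine (\prod_(i | i != k) \int[P]_w (g i (X i w))%:E)%E.
have int_ge0 i : (0 <= \int[P]_w (g i (X i w))%:E)%E.
  by apply: integral_ge0 => w _; rewrite lee_fin.
have c_ge0 : 0 <= c.
  by apply: fine_ge0; rewrite prode_ge0//.
have cE : (c%:E = \prod_(i | i != k) \int[P]_w (g i (X i w))%:E)%E.
  rewrite fineK// prode_fin_num// => i _.
  by rewrite ge0_fin_numE.
rewrite (bigD1 k)//= -cE.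
under eq_integral => w _ do rewrite (bigD1 k)//=.
rewrite (@eq_weighted_integral _ _ _ _ _ P (X k) xi _ _ P (X k) (cst c) (g k))//.
  under eq_integral => w _ do rewrite /= EFinM.
  rewrite ge0_integralZr//.
  - exact/measurable_EFinP.
  - by move=> w _; rewrite lee_fin.
move=> B mB.
have mXB : measurable (X k @^-1` B) by exact: measurable_funPTI.
rewrite [RHS](integral_cst P mXB c%:E) cE.
(* On the event [X k \in B] the claim is the induction hypothesis with the
   factor of index [k] replaced by the indicator of [B]. *)
pose g' i := if i == k then \1_B else g i.
have := IHs g'.
have g'E i : i != k -> g' i = g i by rewrite /g' => /negPf ->.
have g'k : g' k = \1_B by rewrite /g' eqxx.
rewrite (bigD1 k)//= g'k integral_indic_RV// muleC.
rewrite (eq_bigr (fun i => \int[P]_w (g i (X i w))%:E)%E); last first.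
  by move=> i ik; rewrite g'E.
move=> <-.
- rewrite [LHS]integral_mkcond; apply: eq_integral => w _.
  rewrite (bigD1 k)//= g'k patchE indicE.
  rewrite (eq_bigr (fun i => g i (X i w))); last by move=> i ik; rewrite g'E.
  case: ifPn => wB.
    by rewrite mem_set ?mul1r//; rewrite inE in wB.
  by rewrite memNset ?mul0r//; rewrite notin_setE in wB.
- by move=> i; rewrite /g'; case: ifP.
- by move=> i x; rewrite /g'; case: ifP.
- move=> i; rewrite /g'; case: ifP => // /eqP ->.
  by rewrite integral_indic_RV// (le_lt_trans (probability_le1 _ _))// ltry.
- move=> i si; rewrite /g'; case: eqVneq => [_|ik]; first by exists B.
  by apply: g_indic; rewrite inE (negPf ik).
Qed.

Lemma expectation_prod (g : I -> R -> R) :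
  (forall i, measurable_fun setT (g i)) -> (forall i x, 0 <= g i x) ->
  (forall i, (\int[P]_w (g i (X i w))%:E < +oo)%E) ->
  (\int[P]_w (\prod_i g i (X i w))%:E = \prod_i \int[P]_w (g i (X i w))%:E)%E.
Proof.
move=> mg g_ge0 g_fin; apply: (@expectation_prod_seq (enum I)) => // i.
by rewrite mem_enum.
Qed.

End product_formula.
(** * Shifts of a normal variable *)

Section gaussian_shift.
Variable R : realType.
Local Notation mu := (@lebesgue_measure R).

(** The likelihood ratio at [z] of [N(h, s^2)] against [N(0, s^2)]. *)
Definition gauss_lr (s h z : R) : R :=
  expR (h * z / s ^+ 2 - h ^+ 2 / (s ^+ 2 *+ 2)).

Lemma gauss_lr_ge0 s h z : 0 <= gauss_lr s h z.
Proof. exact: expR_ge0. Qed.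

Lemma measurable_gauss_lr s h : measurable_fun setT (gauss_lr s h).
Proof.
apply: measurableT_comp => //; apply: measurable_funB => //.
by apply: measurable_funM => //; apply: measurable_funM.
Qed.

Lemma gauss_lr_pdf s h z : s != 0 ->
  gauss_lr s h z * normal_pdf 0 s z = normal_pdf h s z.
Proof.
move=> s0; rewrite !normal_pdfE// mulrCA /gauss_lr /normal_fun -expRD.
by congr (_ * expR _); field.
Qed.

Lemma gauss_lr_sqr_pdf s h z : s != 0 ->
  gauss_lr s h z ^+ 2 * normal_pdf 0 s z =
  expR (h ^+ 2 / s ^+ 2) * normal_pdf (h *+ 2) s z.
Proof.
move=> s0; rewrite !normal_pdfE// !(mulrCA _ (normal_peak s)).
rewrite /gauss_lr /normal_fun expr2 -!expRD.
by congr (_ * expR _); field.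
Qed.

Lemma lebesgue_measure_shift (h : R) (B : set R) : measurable B ->
  pushforward mu ((fun x => x + h) : _ -> measurableTypeR R) B = mu B.
Proof.
move=> mB; apply/esym/lebesgue_measure_unique => //=.
  exact: measurable_funD.
move=> mh _ [[a b]] _ <-.
rewrite /pushforward.
have -> : (fun x => x + h) @^-1` `]a, b]%classic = `]a - h, b - h]%classic.
  by apply/seteqP; split => x; rewrite /= !in_itv/= ltrBlDr lerBrDr.
rewrite !lebesgue_measure_itv/= !lte_fin ltrD2r.
by case: ifP => // _; rewrite -!EFinD; congr _%:E; ring.
Qed.

Lemma normal_prob_shift s h (B : set R) : s != 0 -> measurable B ->
  normal_prob 0 s ((fun x => x + h) @^-1` B) = normal_prob h s B.
Proof.
move=> s0 mB.
have mh : measurable_fun [set: measurableTypeR R]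
    ((fun x => x + h) : measurableTypeR R -> measurableTypeR R).
  exact: measurable_funD.
transitivity (\int[mu]_(x in (fun x => x + h)%R @^-1` B)
    (normal_pdf h s (x + h)%R)%:E)%E.
  apply: eq_integral => x _; congr _%:E.
  by rewrite !normal_pdfE// /normal_fun; congr (_ * expR _); field.
have <- := @ge0_integral_pushforward _ _ (measurableTypeR R)
  (measurableTypeR R) R _ mh mu B
  (EFin \o normal_pdf h s) mB.
- by apply: eq_measure_integral => A mA _; exact: lebesgue_measure_shift.
- by apply/measurable_EFinP/measurable_funTS; exact: measurable_normal_pdf.
- by move=> x _; rewrite lee_fin normal_pdf_ge0.
Qed.

Section normal_variable.
Context d (Om : measurableType d) (P : probability Om R) (X : {RV P >-> R}).
Variables (s : R) (s0 : s != 0).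
Hypothesis X_normal : forall B, measurable B -> P (X @^-1` B) = normal_prob 0 s B.

Lemma integral_normal_RV (g : R -> R) :
  measurable_fun setT g -> (forall x, 0 <= g x) ->
  (\int[P]_w (g (X w))%:E = \int[mu]_x (g x * normal_pdf 0 s x)%:E)%E.
Proof.
move=> mg g_ge0; rewrite (eq_integral (fun w => (g (X w) * cst 1 w)%:E)).
  apply: (@eq_weighted_integral _ _ _ _ _ P X (cst 1) _ _ mu idfun) => //.
  - exact: measurable_id.
  - exact: measurable_normal_pdf.
  - exact: normal_pdf_ge0.
  - move=> B mB; rewrite preimage_id.
    have mXB : measurable (X @^-1` B) by exact: measurable_funPTI.
    rewrite [LHS](integral_cst P mXB 1%:E) mul1e.
    exact: X_normal.
by move=> w _; rewrite mulr1.
Qed.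

Lemma expectation_gauss_lr_indic h B : measurable B ->
  (\int[P]_w (gauss_lr s h (X w) * \1_B (X w))%:E = normal_prob h s B)%E.
Proof.
move=> mB.
rewrite (integral_normal_RV (g := fun x => gauss_lr s h x * \1_B x)).
- rewrite /normal_prob [RHS]integral_mkcond; apply: eq_integral => x _.
  rewrite patchE indicE mulrAC gauss_lr_pdf//.
  by case: (x \in B); rewrite ?mulr1 ?mulr0.
- by apply: measurable_funM => //; exact: measurable_gauss_lr.
- by move=> x; rewrite mulr_ge0// gauss_lr_ge0.
Qed.

Lemma expectation_gauss_lr_sqr h :
  (\int[P]_w (gauss_lr s h (X w) ^+ 2)%:E = (expR (h ^+ 2 / s ^+ 2))%:E)%E.
Proof.
rewrite (integral_normal_RV (g := fun x => gauss_lr s h x ^+ 2)).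
- under eq_integral do rewrite gauss_lr_sqr_pdf// EFinM.
  rewrite ge0_integralZl_EFin ?expR_ge0//.
  + by rewrite integral_normal_pdf mule1.
  + by move=> x _; rewrite lee_fin normal_pdf_ge0.
  + by apply/measurable_EFinP; exact: measurable_normal_pdf.
- by apply: measurable_funX; exact: measurable_gauss_lr.
- by move=> x; rewrite sqr_ge0.
Qed.

End normal_variable.
End gaussian_shift.

(** * The Cameron-Martin formula for the observation *)

Section change_of_measure.
Context (R : realType) (p1 p2 p3 : nat).
Local Notation I := ('I_p1 * 'I_p2 * 'I_p3)%type.

Definition addt (T h : tensor R p1 p2 p3) : tensor R p1 p2 p3 :=
  fun i j k => T i j k + h i j k.

(** Unlike the cylinders, boxes are stable under intersection, and independence
    gives their probability. *)
Definition box (B : I -> set R) : set (tensor R p1 p2 p3) :=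
  [set Y | forall i j k, B (i, j, k) (Y i j k)].

Definition boxes : set (set (tensor R p1 p2 p3)) :=
  [set S | exists B : I -> set R, (forall x, measurable (B x)) /\ S = box B].

Lemma boxes_setI : setI_closed boxes.
Proof.
move=> _ _ [B [mB ->]] [C [mC ->]]; exists (fun x => B x `&` C x); split.
  by move=> x; exact: measurableI.
apply/seteqP; split=> Y /=.
  by move=> [BY CY] i j k; split; [exact: BY|exact: CY].
by move=> BCY; split=> i j k; case: (BCY i j k).
Qed.

Lemma g_sigma_boxes : <<s boxes>> = <<s @cylinders R p1 p2 p3>>.
Proof.
apply/seteqP; split.
- apply: smallest_sub; first exact: smallest_sigma_algebra.
  move=> _ [B [mB ->]].
  rewrite (_ : box B = \bigcap_(x in [set: I])
      [set Y | B x (Y x.1.1 x.1.2 x.2)]); last first.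
    apply/seteqP; split => Y /=.
      by move=> BY [[i j] k] _; exact: BY.
    by move=> BY i j k; exact: (BY (i, j, k)).
  apply: (@fin_bigcap_measurable _ (g_sigma_algebraType (@cylinders R p1 p2 p3))).
    exact: finite_finset.
  move=> [[i j] k] _; apply: sub_sigma_algebra.
  by exists i, j, k, (B (i, j, k)).
- apply: sub_smallest2r; first exact: smallest_sigma_algebra.
  move=> _ [i [j [k [B [mB ->]]]]].
  exists (fun x => if x == (i, j, k) then B else setT); split.
    by move=> x; case: ifP.
  apply/seteqP; split=> Y /=.
    by move=> BY i' j' k'; case: eqP => // -[-> -> ->].
  by move=> /(_ i j k); rewrite eqxx.
Qed.

Context d (Om : measurableType d) (P : probability Om R).
Context (Z : I -> {RV P >-> R}).

Lemma measurable_fun_obs T :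
  measurable_fun setT (obs Z T : Om -> g_sigma_algebraType (@cylinders R p1 p2 p3)).
Proof.
apply: measurability => // _ [_ [i [j [k [B [mB ->]]]]] <-].
rewrite setTI.
have mTZ : measurable_fun setT (fun w => T i j k + Z (i, j, k) w).
  exact: measurable_funD.
by rewrite -[X in measurable X]setTI; exact: mTZ.
Qed.

Lemma measurable_obs T S : <<s @cylinders R p1 p2 p3>> S ->
  measurable (obs Z T @^-1` S).
Proof.
by move=> mS; rewrite -[X in measurable X]setTI; exact: measurable_fun_obs.
Qed.

Variables (s : R) (s0 : s != 0).
Hypothesis Z_normal : iid_normal Z s.
Local Notation entry T x := (T x.1.1 x.1.2 x.2).

(** The likelihood ratio at [Z] of the noise shifted by [h] against the noise. *)
Definition tensor_lr (h : tensor R p1 p2 p3) (w : Om) : R :=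
  \prod_(x : I) gauss_lr s (entry h x) (Z x w).

Lemma measurable_tensor_lr h : measurable_fun setT (tensor_lr h).
Proof.
rewrite (_ : tensor_lr h = fun w =>
    \prod_(x <- enum {: I}) gauss_lr s (entry h x) (Z x w)).
  apply: measurable_prod => x _.
  by apply: measurableT_comp => //; exact: measurable_gauss_lr.
by apply/funext => w; rewrite /tensor_lr -big_enum.
Qed.

Lemma tensor_lr_ge0 h w : 0 <= tensor_lr h w.
Proof. by apply: prodr_ge0 => x _; exact: gauss_lr_ge0. Qed.

(** The second moment only depends on the norm of [h] relative to [s], not on the
    number of entries. *)
Lemma expectation_tensor_lr_sqr h :
  (\int[P]_w (tensor_lr h w ^+ 2)%:E =
   (expR (\sum_(x : I) entry h x ^+ 2 / s ^+ 2))%:E)%E.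
Proof.
have [indepZ normZ] := Z_normal.
have E2 x : (\int[P]_w (gauss_lr s (entry h x) (Z x w) ^+ 2)%:E =
    (expR (entry h x ^+ 2 / s ^+ 2))%:E)%E.
  by apply: expectation_gauss_lr_sqr => // B mB; exact: normZ.
under eq_integral => w _ do rewrite /tensor_lr -prodrXl.
rewrite (expectation_prod indepZ (g := fun x z => gauss_lr s (entry h x) z ^+ 2)).
- by under eq_bigr do rewrite E2; rewrite prodEFin expR_sum.
- by move=> x; apply: measurable_funX; exact: measurable_gauss_lr.
- by move=> x z; exact: sqr_ge0.
- by move=> x; rewrite E2 ltry.
Qed.

Lemma obs_change_of_measure_box T h (B : I -> set R) :
  (forall x, measurable (B x)) ->
  (P (obs Z (addt T h) @^-1` box B) =
   \int[P]_(w in obs Z T @^-1` box B) (tensor_lr h w)%:E)%E.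
Proof.
move=> mB; have [indepZ normZ] := Z_normal.
pose C x := (fun z => entry T x + z) @^-1` B x.
have mC x : measurable (C x).
  have mT : measurable_fun setT (fun z : R => entry T x + z).
    exact: measurable_funD.
  by rewrite -[X in measurable X]setTI; exact: mT.
pose D x := (fun z => z + entry h x) @^-1` C x.
have mD x : measurable (D x).
  have mh : measurable_fun setT (fun z : R => z + entry h x).
    exact: measurable_funD.
  by rewrite -[X in measurable X]setTI; exact: mh.
transitivity (\prod_x normal_prob (entry h x) s (C x))%E.
  have := indepZ [set: I]%SET D mD.
  rewrite [in X in _ = X -> _](eq_bigl xpredT); last first.
    by move=> x; rewrite finset.in_setT.
  under eq_bigr => x _ do rewrite normZ// normal_prob_shift//.
  move=> <-; congr (P _); apply/seteqP; split => w /=.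
    move=> Bw [[i j] k] _; rewrite /D /C /=.
    have := Bw i j k; rewrite /obs /addt -addrA [h _ _ _ + _]addrC. by [].
  move=> Dw i j k; have := Dw (i, j, k) (finset.in_setT _).
  by rewrite /D /C /= /obs /addt -addrA [h _ _ _ + _]addrC.
have E1 x : (\int[P]_w (gauss_lr s (entry h x) (Z x w) * \1_(C x) (Z x w))%:E =
    normal_prob (entry h x) s (C x))%E.
  by apply: expectation_gauss_lr_indic => // ? ?; exact: normZ.
under eq_bigr do rewrite -E1.
rewrite -(expectation_prod indepZ
  (g := fun x z => gauss_lr s (entry h x) z * \1_(C x) z)).
- rewrite [RHS]integral_mkcond; apply: eq_integral => w _.
  rewrite patchE big_split/= -/(tensor_lr h w).
  case: ifPn => wB.
    rewrite big1 ?mulr1// => -[[i j] k] _; rewrite indicE mem_set//.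
    by move: wB; rewrite inE => /(_ i j k).
  have [i [j [k nB]]] : exists i j k, ~ B (i, j, k) (obs Z T w i j k).
    move: wB; rewrite notin_setE; apply: contra_notP.
    by move=> /forallNP nB i j k; apply: contrapT => ?; apply: (nB i); exists j, k.
  by rewrite [X in _ * X](bigD1 (i, j, k))//= indicE memNset ?mul0r ?mulr0.
- move=> x; apply: measurable_funM => //; exact: measurable_gauss_lr.
- by move=> x z; rewrite mulr_ge0// gauss_lr_ge0.
- move=> x; rewrite E1.
  have /le_lt_trans := probability_le1 (@normal_prob R (entry h x) s) (mC x).
  by apply; exact: ltry.
Qed.

(** The Cameron-Martin formula, extended from boxes to the whole sigma-algebra
    by Dynkin's theorem. *)
Lemma obs_change_of_measure T h S : <<s @cylinders R p1 p2 p3>> S ->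
  (P (obs Z (addt T h) @^-1` S) =
   \int[P]_(w in obs Z T @^-1` S) (tensor_lr h w)%:E)%E.
Proof.
set T' := addt T h.
have mlr D : measurable_fun D (fun w => (tensor_lr h w)%:E).
  by apply/measurable_EFinP/measurable_funTS; exact: measurable_tensor_lr.
have lr_ge0 w : (0 <= (tensor_lr h w)%:E)%E by rewrite lee_fin tensor_lr_ge0.
have mZ U V : <<s @cylinders R p1 p2 p3>> V -> measurable (obs Z U @^-1` V).
  exact: measurable_obs.
have total : (P (obs Z T' @^-1` setT) =
    \int[P]_(w in obs Z T @^-1` setT) (tensor_lr h w)%:E)%E.
  have -> : setT = box (fun=> setT) by apply/seteqP; split.
  exact: obs_change_of_measure_box.
rewrite -g_sigma_boxes; move: S.
apply: (@dynkin_induction _ (g_sigma_algebraType (@cylinders R p1 p2 p3))).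
- by rewrite g_sigma_boxes.
- exact: boxes_setI.
- exact: total.
- by move=> _ [B [mB ->]]; exact: obs_change_of_measure_box.
- move=> S mS PS; rewrite preimage_setC probability_setC; last exact: mZ.
  have := total; rewrite !preimage_setT probability_setT => ->.
  rewrite -(setvU (obs Z T @^-1` S)) ge0_integral_setU//=; last 3 first.
  + by apply: measurableC; exact: mZ.
  + exact: mZ.
  + by apply/disj_setPS; rewrite setICl.
  by rewrite PS addeK// -PS fin_num_measure//; exact: mZ.
- move=> F mF tF PF.
  have tobs U : trivIset setT (fun n => obs Z U @^-1` F n).
    apply/trivIsetP => /= i j _ _ ij; rewrite -preimage_setI.
    by move/trivIsetP : tF => /(_ _ _ _ _ ij) ->//; rewrite preimage_set0.
  rewrite !preimage_bigcup measure_semi_bigcup//; last 2 first.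
  + by move=> n; exact: mZ (mF n).
  + by apply: bigcup_measurable => n _; exact: mZ (mF n).
  rewrite ge0_integral_bigcup//; last by move=> n; exact: mZ (mF n).
  by apply: eq_eseriesr => n _; exact: PF.
Qed.

End change_of_measure.

(** * The two-point lower bound *)

Lemma ge0_integral_linear d (T : measurableType d) (R : realType)
    (mu : {measure set T -> \bar R}) (a b : R) (f g : T -> R) :
  0 <= a -> 0 <= b ->
  measurable_fun setT f -> (forall x, 0 <= f x) ->
  measurable_fun setT g -> (forall x, 0 <= g x) ->
  (\int[mu]_x (a * f x + b * g x)%:E =
   a%:E * \int[mu]_x (f x)%:E + b%:E * \int[mu]_x (g x)%:E)%E.
Proof.
move=> a0 b0 mf f0 mg g0.
under eq_integral do rewrite EFinD !EFinM.
rewrite ge0_integralD//; last 4 first.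
- by move=> x _; rewrite -EFinM lee_fin mulr_ge0.
- by apply/measurable_EFinP; apply: measurable_funM.
- by move=> x _; rewrite -EFinM lee_fin mulr_ge0.
- by apply/measurable_EFinP; apply: measurable_funM.
rewrite !ge0_integralZl_EFin//.
- by move=> x _; rewrite lee_fin.
- exact/measurable_EFinP.
- by move=> x _; rewrite lee_fin.
- exact/measurable_EFinP.
Qed.

Section two_point.
Context (R : realType) (p1 p2 p3 : nat).
Local Notation I := ('I_p1 * 'I_p2 * 'I_p3)%type.
Context d (Om : measurableType d) (P : probability Om R).
Context (Z : I -> {RV P >-> R}).
Variables (s : R) (s0 : s != 0).
Hypothesis Z_normal : iid_normal Z s.
Local Notation entry T x := (T x.1.1 x.1.2 x.2).
Local Notation tensor := (tensor R p1 p2 p3).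

(** The difference of the two probabilities is at most [E |L - 1|], which the
    pointwise inequality [2 eta |L - 1| <= eta^2 + (L - 1)^2] bounds by means of
    [E (L - 1)^2 = E L^2 - 1 <= eta^2].  It is integrated below after moving
    subtracted terms to the other side, so that every integrand is nonnegative. *)
Lemma obs_prob_close (T h : tensor) (eta : R) (S : set tensor) :
  0 < eta -> expR (\sum_(x : I) entry h x ^+ 2 / s ^+ 2) <= 1 + eta ^+ 2 ->
  <<s @cylinders R p1 p2 p3>> S ->
  (P (obs Z (addt T h) @^-1` S) <= P (obs Z T @^-1` S) + eta%:E)%E.
Proof.
move=> eta0 h_small mS.
pose L := tensor_lr Z s h; pose D := obs Z T @^-1` S.
have mD : measurable D by exact: measurable_obs.
have mL : measurable_fun setT L by exact: measurable_tensor_lr.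
have L0 w : 0 <= L w by exact: tensor_lr_ge0.
have mDL : measurable_fun setT (fun w => \1_D w * L w).
  by apply: measurable_funM.
have mL2 : measurable_fun setT (fun w => L w ^+ 2) by exact: measurable_funX.
have EL : (\int[P]_w (L w)%:E = 1)%E.
  have mT : <<s @cylinders R p1 p2 p3>> setT.
    exact: (@measurableT _ (g_sigma_algebraType (@cylinders R p1 p2 p3))).
  have := obs_change_of_measure s0 Z_normal T h mT.
  by rewrite !preimage_setT probability_setT => /esym.
have EDL : (\int[P]_w (\1_D w * L w)%:E = P (obs Z (addt T h) @^-1` S))%E.
  rewrite (obs_change_of_measure s0 Z_normal T h mS) [RHS]integral_mkcond.
  apply: eq_integral => w _; rewrite patchE indicE.
  by rewrite /D; case: (w \in _); rewrite ?mul1r ?mul0r.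
have int_indic : (\int[P]_w (\1_D w)%:E = P D)%E.
  by rewrite integral_indic ?setIT.
have EL2 := expectation_tensor_lr_sqr s0 Z_normal h.
have eta_ge0 := ltW eta0.
have : (\int[P]_w (2 * eta * (\1_D w * L w) + 2 * L w)%:E <=
    \int[P]_w (2 * eta * \1_D w + 1 * ((eta ^+ 2 + 1) * 1 + 1 * L w ^+ 2))%:E)%E.
  apply: ge0_le_integral => //.
  - by move=> w _; rewrite lee_fin addr_ge0// ?mulr_ge0// ?mulr_ge0.
  - by apply/measurable_EFinP; apply: measurable_funD; apply: measurable_funM.
  - apply/measurable_EFinP; apply: measurable_funD; apply: measurable_funM => //.
    by apply: measurable_funD => //; apply: measurable_funM.
  - move=> w _; rewrite lee_fin indicE.
    by case: (w \in D); have := sqr_ge0 (L w - 1 - eta);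
      have := sqr_ge0 (L w - 1); have := sqr_ge0 eta; rewrite /=; nra.
have eta21 : 0 <= eta ^+ 2 + 1 by rewrite addr_ge0// sqr_ge0.
have eta2_ge0 : 0 <= 2 * eta by rewrite mulr_ge0.
have mD1 : measurable_fun setT (\1_D : Om -> R) by exact: measurable_indic.
have DL0 w : 0 <= \1_D w * L w by rewrite mulr_ge0.
have L20 w : 0 <= L w ^+ 2 by rewrite sqr_ge0.
rewrite (ge0_integral_linear P (f := fun w => \1_D w * L w))//.
rewrite (ge0_integral_linear P (f := \1_D)
  (g := fun w => (eta ^+ 2 + 1) * 1 + 1 * L w ^+ 2))//; last 2 first.
- by apply: measurable_funD; apply: measurable_funM.
- by move=> w; rewrite addr_ge0// mulr_ge0.
rewrite (ge0_integral_linear P (f := cst 1))//.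
have -> : (\int[P]_w (cst 1 w)%:E = 1)%E.
  by rewrite [LHS](integral_cst P measurableT 1%:E) mul1e; exact: probability_setT.
rewrite EDL EL int_indic EL2 -/D.
have mS' : measurable (obs Z (addt T h) @^-1` S) by exact: measurable_obs.
rewrite -(fineK (fin_num_measure P _ mD)) -(fineK (fin_num_measure P _ mS')).
rewrite -?(EFinM, EFinD) !lee_fin.
by move: h_small; nra.
Qed.

Lemma probability_setI_ge (A B : set Om) : measurable A -> measurable B ->
  (P A + P B <= 1 + P (A `&` B))%E.
Proof.
move=> mA mB; rewrite (measureDI P mA mB) addeAC leeD2r//.
rewrite -(probability_setT P) -measureU.
- by apply: le_measure; rewrite ?inE//; apply: measurableU => //; exact: measurableD.
- exact: measurableD.
- by [].
- by rewrite setDKI.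
Qed.

(** Both coverage events have probability at least [1 - alpha - eta] under the
    signal [T], so that they meet with probability at least
    [1 - 2 alpha - eta = eta]; on their intersection the interval contains both
    values of the functional. *)
Lemma two_point_minimax_length (alpha : R) (Th : set tensor) (A T h : tensor) :
  let eta := (1 - 2 * alpha) / 2 in
  alpha < 1 / 2 -> Th T -> Th (addt T h) ->
  expR (\sum_(x : I) entry h x ^+ 2 / s ^+ 2) <= 1 + eta ^+ 2 ->
  ((eta * `|tdot h A|)%:E <= minimax_length Z alpha Th A)%E.
Proof.
move=> eta alpha_lt ThT ThTh h_small.
have eta0 : 0 < eta by rewrite /eta; lra.
apply: le_ereal_inf_tmp => _ /= [[l u] [ml mu cover] <-].
apply: le_trans (ereal_sup_ubound _); last by exists T.
pose a0 := tdot T A; pose a1 := tdot (addt T h) A.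
have a01 : a1 - a0 = tdot h A.
  rewrite /a1 /a0 /tdot -sumrB; apply: eq_bigr => i _.
  rewrite -sumrB; apply: eq_bigr => j _; rewrite -sumrB.
  by apply: eq_bigr => k _; rewrite /addt; ring.
pose S a : set tensor := [set Y | l Y <= a <= u Y].
have mS a : <<s @cylinders R p1 p2 p3>> (S a).
  rewrite (_ : S a = l @^-1` `]-oo, a] `&` u @^-1` `[a, +oo[); last first.
    apply/seteqP; split => Y; rewrite /S /= !in_itv/= andbT.
      by move=> /andP.
    by move=> [-> ->].
  apply: (@measurableI _ (g_sigma_algebraType (@cylinders R p1 p2 p3))).
    by rewrite -[X in measurable X]setTI; exact: ml.
  by rewrite -[X in measurable X]setTI; exact: mu.
have mSo a U : measurable (obs Z U @^-1` S a) by exact: measurable_obs.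
have cov U : Th U -> ((1 - alpha)%:E <= P (obs Z U @^-1` S (tdot U A)))%E.
  by move=> ThU; apply: (le_trans cover); apply: ereal_inf_lbound; exists U.
set E := obs Z T @^-1` S a0 `&` obs Z T @^-1` S a1.
have mE : measurable E by exact: measurableI.
have PE : (eta%:E <= P E)%E.
  have := probability_setI_ge (mSo a0 T) (mSo a1 T).
  have := cov _ ThT; have := cov _ ThTh.
  have := obs_prob_close T eta0 h_small (mS a1).
  rewrite -/a0 -/a1 -/E.
  rewrite -(fineK (fin_num_measure P _ mE)).
  rewrite -(fineK (fin_num_measure P _ (mSo a0 T))).
  rewrite -(fineK (fin_num_measure P _ (mSo a1 T))).
  rewrite -(fineK (fin_num_measure P _ (mSo a1 (addt T h)))).
  by rewrite -?(EFinM, EFinD) !lee_fin /eta; lra.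
rewrite /expected_length unlock.
apply: (@le_trans _ _ (\int[P]_w (`|tdot h A| * \1_E w)%:E)%E).
  under eq_integral do rewrite EFinM.
  rewrite ge0_integralZl_EFin//.
  - by rewrite integral_indic// setIT mulrC EFinM lee_wpmul2l// lee_fin.
  - by apply/measurable_EFinP.
have mlength : measurable_fun setT (fun w => length (l, u) (obs Z T w)).
  have mobs := measurable_fun_obs Z T.
  apply: measurable_maxr => //; apply: measurable_funB.
    exact: (measurableT_comp mu mobs).
  exact: (measurableT_comp ml mobs).
apply: ge0_le_integral => //.
- by apply/measurable_EFinP; apply: measurable_funM.
- exact/measurable_EFinP.
move=> w _; rewrite lee_fin indicE /length /=.
case: (boolP (w \in E)); last by rewrite mulr0 le_max lexx.
rewrite inE => -[/andP[/= l0 u0] /andP[/= l1 u1]].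
rewrite mulr1 le_max -a01; apply/orP; right.
by rewrite ler_norml; apply/andP; split; lra.
Qed.

End two_point.

Unset Implicit Arguments.

(* The constant c3 depends on alpha, kappa, the ranks, and on (lambda, sigma)
   only through an arbitrary positive lower bound rho of lambda / sigma; it is
   uniform in p1, p2, p3, A and T. No constant uniform in lambda / sigma > 0, or
   in the ranks, exists: with p = r = (1, 1, 1) the constant interval
   [- kappa * lambda, kappa * lambda] always covers; with p = r = (1, n, n),
   A the identity matrix and kappa < sqrt 2, it always covers as well. *)
Theorem theorem4p3 (R : realType) (alpha kappa : R)
    (r1 r2 r3 : nat) (rho : R)
    (halpha : 0 < alpha < 1 / 2) (hkappa : 1 < kappa) (hrho : 0 < rho) :
  exists c3 : R, 0 < c3 /\
    forall (p1 p2 p3 : nat) (sigma lambda : R)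
      (d : measure_display) (Om : measurableType d) (P : probability Om R)
      (Z : 'I_p1 * 'I_p2 * 'I_p3 -> {RV P >-> R})
      (A : tensor R p1 p2 p3),
      0 < sigma -> rho <= lambda / sigma -> iid_normal Z sigma ->
      forall (G : tensor R r1 r2 r3) (U1 : 'M[R]_(p1, r1))
        (U2 : 'M[R]_(p2, r2)) (U3 : 'M[R]_(p3, r3)),
        orthonormal_cols U1 -> orthonormal_cols U2 -> orthonormal_cols U3 ->
        Theta r1 r2 r3 lambda kappa (mode123 G U1 U2 U3) ->
        ((c3 * sigma * std_err A G U1 U2 U3)%:E
         <= minimax_length Z alpha (Theta r1 r2 r3 lambda kappa) A)%E.
Proof.
pose eta := (1 - 2 * alpha) / 2.
have eta0 : 0 < eta by rewrite /eta; lra.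
have eta21 : 1 < 1 + eta ^+ 2 by rewrite ltrDl exprn_gt0.
pose eps := Num.sqrt (ln (1 + eta ^+ 2)).
have eps0 : 0 < eps by rewrite sqrtr_gt0 ln_gt0.
(* The first bound keeps the two laws close, the second keeps
   [lambda + delta * sigma] below [kappa * lambda]. *)
pose delta := Num.min eps ((kappa - 1) * rho).
have delta0 : 0 < delta by rewrite lt_min eps0 mulr_gt0// subr_gt0.
have delta_eta : expR (delta ^+ 2) <= 1 + eta ^+ 2.
  rewrite -[leRHS]lnK ?posrE ?(lt_trans _ eta21)// ler_expR.
  rewrite -(sqr_sqrtr (ltW (ln_gt0 eta21))).
  rewrite ler_pXn2r ?nnegrE ?(ltW delta0) ?(ltW eps0)//.
  by rewrite /delta ge_min lexx.
have alpha_lt : alpha < 1 / 2 by case/andP: halpha.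
pose K := Num.sqrt (r3 * r2 + r1 * r3 + r2 * r1 + r1 * r2 * r3)%:R : R.
have K0 : 0 <= K by exact: sqrtr_ge0.
have K1 : 0 < K + 1 by rewrite ltr_wpDl.
pose c3 := eta * delta / (K + 1).
have c30 : 0 < c3 by rewrite divr_gt0// mulr_gt0.
exists c3; split => //.
move=> p1 p2 p3 sigma lambda d Om P Z A sigma0 hlambda hZ G U1 U2 U3 o1 o2 o3 hT.
have sigma_neq0 : sigma != 0 by rewrite gt_eqF.
(* The trivial case: the pair [T], [T] already gives a nonnegative bound. *)
have [SE0|SE0] := leP (std_err A G U1 U2 U3) 0.
  apply: (@le_trans _ _ 0%E).
    by rewrite lee_fin mulr_ge0_le0// mulr_ge0// ltW.
  have := @two_point_minimax_length R p1 p2 p3 d Om P Z sigma sigma_neq0 hZ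
    alpha (Theta r1 r2 r3 lambda kappa) A (mode123 G U1 U2 U3) (fun _ _ _ => 0).
  have -> : addt (mode123 G U1 U2 U3) (fun _ _ _ => 0) = mode123 G U1 U2 U3.
    by do 3 apply/funext => ?; rewrite /addt addr0.
  move=> /(_ alpha_lt hT hT) H; apply: le_trans (H _).
    by rewrite lee_fin mulr_ge0// ltW.
  by rewrite big1 ?expR0 ?(ltW eta21)// => x _; rewrite expr0n/= mul0r.
pose b := std_err A G U1 U2 U3 / (K + 1).
have b0 : 0 < b by rewrite divr_gt0.
(* The supremum over elementary tensors exceeds [b]: otherwise the standard error
   would be at most [K * b], which is less than itself. *)
have [e1 [e2 [e3 [u [v [w [[ou ov ow] Abig]]]]]]] : exists e1 : 'I_r1,
    exists e2 : 'I_r2, exists e3 : 'I_r3, exists u : 'cV[R]_p1,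
    exists v : 'cV[R]_p2, exists w : 'cV[R]_p3,
    [/\ orthonormal_cols u, orthonormal_cols v & orthonormal_cols w] /\
    b < tdot (rank1 1 u v w) A.
  apply: contrapT => nA.
  have Ab : 'I_r1 -> 'I_r2 -> 'I_r3 -> rank1_bound A b.
    move=> e1 e2 e3 u v w ou ov ow; rewrite leNgt; apply/negP => Ab.
    by apply: nA; exists e1, e2, e3, u, v, w.
  have := rank1_bound_std_err G (ltW b0) o1 o2 o3 Ab; rewrite -/K.
  have : std_err A G U1 U2 U3 = (K + 1) * b.
    by rewrite /b mulrC divfK// gt_eqF.
  by move=> ->; rewrite mulrDl mul1r; lra.
have lambda_ge : rho * sigma <= lambda by rewrite -ler_pdivlMr.
have lambda0 : 0 < lambda by rewrite (lt_le_trans _ lambda_ge)// mulr_gt0.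
have delta_lambda : delta * sigma <= (kappa - 1) * lambda.
  apply: (@le_trans _ _ ((kappa - 1) * rho * sigma)).
    by rewrite ler_pM2r// /delta ge_min lexx orbT.
  by rewrite -mulrA ler_pM2l// subr_gt0.
have ds0 : 0 < delta * sigma by rewrite mulr_gt0.
have := @two_point_minimax_length R p1 p2 p3 d Om P Z sigma sigma_neq0 hZ
  alpha (Theta r1 r2 r3 lambda kappa) A (rank1 lambda u v w)
  (rank1 (delta * sigma) u v w).
have -> : addt (rank1 lambda u v w) (rank1 (delta * sigma) u v w) =
    rank1 (lambda + delta * sigma) u v w.
  by do 3 apply/funext => ?; rewrite /addt /rank1 -mulrDl.
move=> H; apply: le_trans (H _ _ _ _) => //.
- rewrite lee_fin tdot_rank1 -/eta normrM (gtr0_norm ds0).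
  rewrite (gtr0_norm (lt_trans b0 Abig)).
  have -> : c3 * sigma * std_err A G U1 U2 U3 = eta * (delta * sigma * b).
    by rewrite /c3 /b; field; rewrite gt_eqF.
  by rewrite ler_pM2l// ler_pM2l// ltW.
- apply: (rank1_Theta e1 e2 e3 o1 o2 o3 ou ov ow lambda0).
  by rewrite lexx/= ler_pMl// ltW.
- apply: (rank1_Theta e1 e2 e3 o1 o2 o3 ou ov ow).
    by rewrite addr_gt0.
  by apply/andP; split; lra.
rewrite (_ : \sum_x _ = delta ^+ 2)//.
have /orthonormal_colP uu := ou; have /orthonormal_colP vv := ov.
have /orthonormal_colP ww := ow.
transitivity (delta ^+ 2 * ((\sum_i u i 0 ^+ 2) * (\sum_j v j 0 ^+ 2) *
    (\sum_k w k 0 ^+ 2))); last by rewrite uu vv ww !mulr1.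
rewrite big_distrlr/= pair_big/= big_distrlr/= pair_big/= mulr_sumr.
by apply: eq_bigr => x _; rewrite /rank1; field.
Qed.
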